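(* For every integer $k\geq R(2^{74},2^{75}-6)$, the only tight $(k,1)$-stable graphs (on at least $k$ vertices) are, up to isomorphism, $K_k$ and the spanning subgraphs of $K_{k+1}$ or of $K_{k+2}$ with independence number two. In particular, for every integer $k\geq R(2^{74},2^{75}-6)$, every tight $(k,1)$-stable graph has at most $k+2$ vertices.
   Context: All graphs are finite, simple and undirected. $\alpha(G)$ denotes the independence number of $G$ (with $\alpha=0$ for the graph with no vertices), and $G-S$ denotes the subgraph of $G$ induced on $V(G)\setminus S$. For integers $k>\ell\geq 0$, a graph $G$ is $(k,\ell)$-stable if for every $S\subseteq V(G)$ with $|S|=k$ we have $\alpha(G-S)\geq \alpha(G)-\ell$. A $(k,\ell)$-stable graph $G$ on $n$ vertices is tight if $\alpha(G)=\left\lfloor \frac{n-k+1}{2}\right\rfloor+\ell$. $R(s,t)$ denotes the Ramsey number: the minimum integer $N$ such that every graph on $n\geq N$ vertices contains either an independent set of $s$ vertices or a clique of $t$ vertices. *)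

(* Defs.v *)
From HB Require Import structures.
From mathcomp Require Import all_boot all_order all_algebra.
From mathcomp Require Import boolp.

Set Implicit Arguments.
Unset Strict Implicit.
Unset Printing Implicit Defensive.

Record graph (T : finType) := Graph {
  adj : rel T;
  adj_sym : symmetric adj;
  adj_irr : irreflexive adj }.

Definition independent (T : finType) (G : graph T) (A : {set T}) : bool :=
  [forall x in A, forall y in A, ~~ adj G x y].

Definition clique (T : finType) (G : graph T) (A : {set T}) : bool :=
  [forall x in A, forall y in A, (x != y) ==> adj G x y].

(* The empty set is independent, so alpha is 0 when T has no elements. *)
Definition alpha (T : finType) (G : graph T) : nat :=
  \max_(A : {set T} | independent G A) #|A|.

Definition induced_adj (T : finType) (G : graph T) (A : {set T}) :
    rel {x : T | x \in A} :=
  fun x y => adj G (val x) (val y).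

Lemma induced_sym (T : finType) (G : graph T) (A : {set T}) :
  symmetric (induced_adj G (A := A)).
Proof. by move=> x y; apply: adj_sym. Qed.

Lemma induced_irr (T : finType) (G : graph T) (A : {set T}) :
  irreflexive (induced_adj G (A := A)).
Proof. by move=> x; apply: adj_irr. Qed.

Definition induced (T : finType) (G : graph T) (A : {set T}) :
    graph {x : T | x \in A} :=
  Graph (@induced_sym T G A) (@induced_irr T G A).

Definition delete (T : finType) (G : graph T) (S : {set T}) :
    graph {x : T | x \in ~: S} :=
  induced G (~: S).

(* Truncated subtraction is harmless here: the other side is nonnegative. *)
Definition stable (k l : nat) (T : finType) (G : graph T) : Prop :=
  forall S : {set T}, #|S| = k -> alpha G - l <= alpha (delete G S).

(* The floor is taken in int because #|T| - k + 1 may be negative. *)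
Definition tight (k l : nat) (T : finType) (G : graph T) : Prop :=
  stable k l G /\
  ((alpha G)%:Z = ((#|T|%:Z - k%:Z + 1) %/ 2)%Z + l%:Z)%R.

Definition isomorphic (T T' : finType) (G : graph T) (H : graph T') : Prop :=
  exists f : T -> T',
    bijective f /\ forall x y : T, adj H (f x) (f y) = adj G x y.

Definition spanning_subgraph (T : finType) (H G : graph T) : Prop :=
  forall x y : T, adj H x y -> adj G x y.

Lemma complete_sym (n : nat) : symmetric (fun i j : 'I_n => i != j).
Proof. by move=> i j; rewrite eq_sym. Qed.

Lemma complete_irr (n : nat) : irreflexive (fun i j : 'I_n => i != j).
Proof. by move=> i; rewrite eqxx. Qed.

Definition complete (n : nat) : graph 'I_n :=
  Graph (@complete_sym n) (@complete_irr n).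

Definition ramsey_property (s t N : nat) : Prop :=
  forall (T : finType) (G : graph T), N <= #|T| ->
    (exists A : {set T}, independent G A /\ #|A| = s) \/
    (exists A : {set T}, clique G A /\ #|A| = t).

Lemma ramsey_property_in (s t : nat) :
  exists N, forall (T : finType) (G : graph T) (X : {set T}), N <= #|X| ->
    (exists A : {set T}, [/\ A \subset X, independent G A & #|A| = s]) \/
    (exists A : {set T}, [/\ A \subset X, clique G A & #|A| = t]).
Proof.
have [m] := ubnP (s + t); elim: m s t => // m IHm [|s] [|t] lt_m.
1-2: exists 0 => T G X _; left; exists set0; rewrite cards0 sub0set;
  by split=> //; apply/forall_inP=> x; rewrite inE.
- exists 0 => T G X _; right; exists set0; rewrite cards0 sub0set.
  by split=> //; apply/forall_inP=> x; rewrite inE.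
have [|N1 HN1] := IHm s t.+1; first by rewrite -ltnS -addSn.
have [|N2 HN2] := IHm s.+1 t; first by rewrite -ltnS -addnS.
exists (N1 + N2).+1 => T G X leX.
have /card_gt0P[v vX] : 0 < #|X| by apply: leq_trans leX.
pose Y := [set x in X | adj G v x].
pose Z := [set x in X | (x != v) && ~~ adj G v x].
have YX : Y \subset X by apply/subsetP=> x; rewrite inE => /andP[].
have ZX : Z \subset X by apply/subsetP=> x; rewrite inE => /andP[].
have leYZ : N1 + N2 <= #|Z| + #|Y|.
  rewrite -ltnS (leq_trans leX) // (cardsD1 v X) vX ltnS.
  apply: leq_trans (leq_card_setU Z Y); apply/subset_leq_card/subsetP=> x.
  by rewrite !inE => /andP[-> ->]; case: (adj G v x).
have [leZ|ltZ] := leqP N1 #|Z|.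
  have [[A [AZ iA cA]]|[A [AZ ? ?]]] := HN1 T G Z leZ; last first.
    by right; exists A; split=> //; apply: subset_trans ZX.
  have inZ x : x \in A -> (x != v) && ~~ adj G v x.
    by move/(subsetP AZ); rewrite inE => /andP[].
  left; exists (v |: A); split.
  - by rewrite subUset sub1set vX (subset_trans AZ).
  - apply/forall_inP=> x /setU1P[->|xA]; apply/forall_inP=> y /setU1P[->|yA].
    + by rewrite adj_irr.
    + by case/andP: (inZ y yA).
    + by rewrite adj_sym; case/andP: (inZ x xA).
    + by move/forall_inP/(_ x xA)/forall_inP: iA; apply.
  - rewrite cardsU1 cA; case: (boolP (v \in A)) => // /inZ.
    by rewrite eqxx.
have leY : N2 <= #|Y|.
  rewrite -(leq_add2l N1) (leq_trans leYZ) // leq_add2r; exact: ltnW.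
have [[A [AY ? ?]]|[A [AY iA cA]]] := HN2 T G Y leY.
  by left; exists A; split=> //; apply: subset_trans YX.
have inY x : x \in A -> adj G v x.
  by move/(subsetP AY); rewrite inE => /andP[].
right; exists (v |: A); split.
- by rewrite subUset sub1set vX (subset_trans AY).
- apply/forall_inP=> x /setU1P[->|xA]; apply/forall_inP=> y /setU1P[->|yA].
  + by rewrite eqxx.
  + by rewrite inY ?implybT.
  + by rewrite adj_sym inY ?implybT.
  + by move/forall_inP/(_ x xA)/forall_inP: iA; apply.
- rewrite cardsU1 cA; case: (boolP (v \in A)) => // /inY.
  by rewrite adj_irr.
Qed.

Lemma ramsey_property_exists (s t : nat) :
  exists N, `[< ramsey_property s t N >].
Proof.
have [N HN] := ramsey_property_in s t; exists N; apply/asboolP => T G leN.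
have [|[A [_ ? ?]]|[A [_ ? ?]]] := HN T G setT; first by rewrite cardsT.
  by left; exists A.
by right; exists A.
Qed.

Definition ramsey (s t : nat) : nat := ex_minn (ramsey_property_exists s t).

(* Main.v *)
Require Import Defs.
From mathcomp Require Import all_boot all_order all_algebra zify.

Set Implicit Arguments.
Unset Strict Implicit.
Unset Printing Implicit Defensive.

(** Put n = #|T|, m = n - k and a = ceil(m/2), so that tightness reads
    alpha G = a + 1, and stability says that every set of m vertices contains
    an independent set of size a.  Everything reduces to an absolute bound
    alpha G <= 14, that is m <= 26: then the hypothesis on k yields a clique
    with more than m vertices, as there is no large independent set, and a set
    of m vertices inside that clique has independence number at most 1, which
    forces a <= 1 and m <= 2.  A graph with k, k+1 or k+2 vertices is then
    recognised from its independence number.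

    The bound on alpha comes from a statement about graphs G[X] whose
    independence number a survives the removal of any K+1 vertices
    ([robust]).  Such graphs expand: |N(I)| >= |I| + K for every nonempty
    independent I ([robust_expansion]), so |X| >= 2a + K if a > 0, and the
    graphs of interest are those where the excess |X| - 2a - K is bounded.  Fix
    a vertex x and choose Y inclusion-minimal among the vertex sets that meet all the
    independent a-sets avoiding x.  Robustness makes Y larger than K, and
    minimality gives, for each y in Y, an independent a-set J y with
    J y :&: Y = {y} ([critical_family]).  Expansion and an exchange argument
    show that no vertex lies in more than |X| + 2 - 2a - K of the sets J y
    ([multiplicity]).  Counting incidences between Y and X yields
    (K+1) a <= (|X| + 2 - 2a - K) |X| ([robust_bound]), which bounds a as soon
    as K is large compared with the excess.

    A tight (k,1)-stable graph falls in this setting in one of two ways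
    ([stable1_alpha_le]).  Either some set S of at most k - 12 vertices lowers
    alpha, and then G - S keeps its independence number a after any k - |S|
    further removals; or no such S exists and G itself keeps alpha after any
    k - 12 removals.  The excess is bounded by a constant in both cases. *)

(** * Finite sets of prescribed size *)

(* Cardinals are opaque atoms here; generalizing them keeps the arithmetic
   procedure from comparing the underlying set expressions by conversion. *)
Ltac card_lia :=
  clear;
  repeat match goal with |- context [card ?A] => generalize (card A); intro end;
  lia.

Lemma exists_subset_card (T : finType) (A : {set T}) (j : nat) :
  j <= #|A| -> exists2 B : {set T}, B \subset A & #|B| = j.
Proof.
case/card_geqP => s [us <- sA]; exists [set x in s].
  by apply/subsetP => x; rewrite inE; apply: sA.
by rewrite cardsE; apply/card_uniqP.
Qed.

Lemma exists_superset_card (T : finType) (A : {set T}) (j : nat) :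
  #|A| <= j <= #|T| -> exists2 B : {set T}, A \subset B & #|B| = j.
Proof.
case/andP => leAj lejT.
have [|B sBA cB] := @exists_subset_card T (~: A) (#|T| - j).
  by have := cardsC A; lia.
exists (~: B); first by rewrite -setCS setCK.
by have := cardsC B; lia.
Qed.

(** * Independent sets, neighbourhoods and exchange *)

Lemma independentP (T : finType) (G : graph T) (A : {set T}) :
  reflect {in A &, forall x y, ~~ adj G x y} (independent G A).
Proof.
apply: (iffP forall_inP) => [h x y xA yA | h x xA].
  by have /forall_inP := h x xA; apply.
by apply/forall_inP => y yA; apply: h.
Qed.

Lemma independent_sub (T : finType) (G : graph T) (A B : {set T}) :
  A \subset B -> independent G B -> independent G A.
Proof.
move=> /subsetP sAB /independentP iB; apply/independentP => x y xA yA.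
by apply: iB; apply: sAB.
Qed.

Definition nbhd (T : finType) (G : graph T) (A : {set T}) : {set T} :=
  [set v | [exists u in A, adj G u v]].

Lemma nbhdP (T : finType) (G : graph T) (A : {set T}) v :
  reflect (exists2 u, u \in A & adj G u v) (v \in nbhd G A).
Proof. by rewrite inE; apply: exists_inP. Qed.

Lemma nbhdS (T : finType) (G : graph T) (A B : {set T}) :
  A \subset B -> nbhd G A \subset nbhd G B.
Proof.
move=> /subsetP sAB; apply/subsetP => v /nbhdP[u uA uv].
by apply/nbhdP; exists u => //; apply: sAB.
Qed.

Lemma independent_nbhd (T : finType) (G : graph T) (A : {set T}) :
  independent G A -> [disjoint A & nbhd G A].
Proof.
move=> /independentP iA; apply/pred0P => v /=.
apply/negbTE/negP => /andP[vA /nbhdP[u uA uv]].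
by have := iA u v uA vA; rewrite uv.
Qed.

(** Exchanging inside J the neighbours of A for A itself: comparing the size of
    the result with the independence number is how every maximality argument
    below proceeds. *)
Lemma exchange (T : finType) (G : graph T) (A J : {set T}) :
  independent G A -> independent G J ->
  independent G (A :|: (J :\: nbhd G A)) /\
  #|A :|: (J :\: nbhd G A)| + #|J :&: nbhd G A| = #|J| + #|A :\: J|.
Proof.
move=> iA iJ; have dA := independent_nbhd iA.
have nAJ x y : x \in A -> y \in J :\: nbhd G A -> ~~ adj G x y.
  move=> xA /setDP[_]; apply: contra => xy; apply/nbhdP; by exists x.
split.
  apply/independentP => x y /setUP[] xH /setUP[] yH.
  - by move/independentP: iA; apply.
  - exact: nAJ.
  - by rewrite adj_sym; apply: nAJ.
  - by move: xH yH => /setDP[xJ _] /setDP[yJ _]; move/independentP: iJ; apply.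
have -> : A :|: (J :\: nbhd G A) = (A :\: J) :|: (J :\: nbhd G A).
  apply/setP => v; have := disjointFr dA (x := v).
  by rewrite !inE; case: (v \in A) (v \in J) => [] [] //= ->.
rewrite cardsU (_ : _ :&: _ = set0) ?cards0; last first.
  by apply/setP => v; rewrite !inE; case: (v \in J); rewrite ?andbF.
by have := cardsID (nbhd G A) J; lia.
Qed.

(** * Independence numbers that survive vertex deletions *)

(** For #|X| >= K this says that G[X] is (K,0)-stable with independence number
    a.  Working with a subset X of a fixed vertex type avoids towers of induced
    subgraphs, and allowing all S with at most K elements, rather than exactly
    K, saves padding them. *)
Definition robust (T : finType) (G : graph T) (X : {set T}) (K a : nat) : Prop :=
  (forall J : {set T}, J \subset X -> independent G J -> #|J| <= a) /\
  (forall S : {set T}, #|S| <= K -> exists J : {set T},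
     [/\ J \subset X :\: S, independent G J & #|J| = a]).

(** If I is a smallest failure, delete one vertex x of I together with K of the
    neighbours of I, and take an independent a-set J in what is left.  The set
    A := I :&: J omits x, so it is smaller than I and expands, or is empty;
    either way J retains fewer than #|I :\: J| neighbours of I, and exchanging
    them for I produces an independent set that is too large. *)
Lemma robust_expansion (T : finType) (G : graph T) (X : {set T}) (K a : nat) :
  robust G X K.+1 a -> forall I : {set T},
  I \subset X -> independent G I -> I != set0 -> #|I| + K <= #|nbhd G I :&: X|.
Proof.
move=> [maxa rob] I; have [m] := ubnP #|I|; elim: m I => // m IHm I ltIm sIX iI.
case/set0Pn => x xI; case: leqP => // ltN; exfalso.
set N := nbhd G I :&: X in ltN.
(* When I has fewer than K neighbours, all of them are deleted. *)
have [|S sSN cS] := @exists_subset_card T N (minn #|N| K); first lia.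
have [| J [sJ iJ cJ]] := rob (x |: S).
  by rewrite cardsU1 cS; case: (x \in S) => /=; lia.
have sJX : J \subset X by apply: subset_trans sJ (subsetDl _ _).
have xJ : x \notin J.
  by apply/negP => /(subsetP sJ); rewrite !inE eqxx.
have [iE cE] := exchange iI iJ.
have leE : #|I :|: (J :\: nbhd G I)| <= a.
  by apply: maxa iE; rewrite subUset sIX (subset_trans (subsetDl _ _)).
set A := I :&: J.
have sAI : A \subset I by apply: subsetIl.
have cA : #|A| + #|I :\: J| = #|I| by apply: cardsID.
have ltA : #|A| < #|I|.
  apply: proper_card; apply/properP; split=> //; exists x => //.
  by rewrite inE (negbTE xJ) andbF.
have sJN : J :&: nbhd G I \subset N :\: S :\: nbhd G A.
  apply/subsetP => v /setIP[vJ vN].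
  have := subsetP sJ v vJ; rewrite in_setD in_setU1 negb_or.
  case/andP => /andP[_ vS] vX; rewrite !in_setD in_setI vS vX vN /= andbT.
  apply/negP => /nbhdP[u /setIP[_ uJ] uv].
  by move/independentP: iJ => /(_ u v uJ vJ); rewrite uv.
have leJN := subset_leq_card sJN.
have cNS : #|N :\: S| + #|S| = #|N|.
  by have := cardsID S N; rewrite (setIidPr sSN); card_lia.
have cND := cardsID (nbhd G A) (N :\: S).
have [A0 | A0] := eqVneq A set0.
  move: cA ltA cE leE cJ leJN cNS cND cS ltN; rewrite A0 cards0; card_lia.
have := IHm A (leq_trans ltA ltIm) (subset_trans sAI sIX)
  (independent_sub sAI iI) A0.
have : #|nbhd G A :&: X| <= #|(N :\: S) :&: nbhd G A| + #|S|.
  apply: leq_trans (leq_card_setU _ _); apply/subset_leq_card/subsetP => v.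
  case/setIP => vA vX; rewrite in_setU in_setI in_setD in_setI vA vX.
  by rewrite (subsetP (nbhdS _ sAI) v vA) !andbT orNb.
move: cA cE leE cJ leJN cNS cND cS ltN; card_lia.
Qed.

(** * Critical stars *)

(** When a is the independence number of G[X], this is what remains at x after
    deleting from G[X] an inclusion-maximal set of edges at x whose deletion
    does not raise the independence number: Y is the remaining neighbourhood of
    x, and x |: (J y) becomes independent once the edge xy is deleted too. *)
Definition critical_star (T : finType) (G : graph T) (X : {set T}) (a : nat)
    (x : T) (Y : {set T}) (J : T -> {set T}) : Prop :=
  (forall B : {set T}, B \subset X :\ x -> independent G B ->
     [disjoint B & Y] -> #|B| < a) /\
  (forall y, y \in Y -> [/\ J y \subset X :\ x, independent G (J y),
     #|J y| = a & J y :&: Y = [set y]]).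

(** The neighbourhood of x meets every independent a-set avoiding x, since x
    could otherwise be added.  Take Y minimal with this property: minimality
    provides the sets J y, and if Y had at most K elements then deleting x and Y
    would leave an independent a-set missing Y. *)
Lemma critical_family (T : finType) (G : graph T) (X : {set T}) (K a : nat) x :
  robust G X K.+1 a -> x \in X ->
  exists (Y : {set T}) (J : T -> {set T}),
    K < #|Y| /\ critical_star G X a x Y J.
Proof.
move=> [maxa rob] xX.
pose hits (Y : {set T}) := [forall B : {set T},
  (B \subset X :\ x) && independent G B && [disjoint B & Y] ==> (#|B| < a)].
have [|Y /minsetP[hY minY] _] := @minset_exists T hits (nbhd G [set x]).
  apply/forallP => B; apply/implyP => /andP[/andP[sB iB] dB].
  have ix : independent G [set x].
    by apply/independentP => u v /set1P-> /set1P->; rewrite adj_irr.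
  have [iE cE] := exchange ix iB.
  have sBX : B \subset X by apply: subset_trans sB (subsetDl _ _).
  have leE : #|[set x] :|: (B :\: nbhd G [set x])| <= a.
    by apply: maxa iE; rewrite subUset sub1set xX (subset_trans (subsetDl _ _)).
  have xB : x \notin B by apply/negP => /(subsetP sB); rewrite !inE eqxx.
  move: cE; rewrite (eqP (etrans (setI_eq0 _ _) dB)) cards0 addn0.
  have -> : [set x] :\: B = [set x].
    by apply/setDidPl; rewrite disjoints1.
  by rewrite cards1; lia.
have hitY (B : {set T}) : B \subset X :\ x -> independent G B ->
    [disjoint B & Y] -> #|B| < a.
  by move=> sB iB dB; have /forallP/(_ B) := hY; rewrite sB iB dB.
pose good y (B : {set T}) := [&& B \subset X :\ x, independent G B, #|B| == a
  & B :&: Y == [set y]].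
have exJ y : y \in Y -> exists B, good y B.
  move=> yY.
  have /forallPn[B] : ~~ hits (Y :\ y).
    by apply/negP => /minY/(_ (subD1set _ _)) /setP/(_ y); rewrite !inE eqxx yY.
  rewrite negb_imply -leqNgt => /andP[/andP[/andP[sB iB] dB] leB]; exists B.
  have sBX : B \subset X by apply: subset_trans sB (subsetDl _ _).
  rewrite /good sB iB eqn_leq leB maxa //=.
  have BY v : v \in B -> v \in Y -> v = y.
    move=> vB vY; apply/eqP; apply: contraFT (disjointFr dB vB) => vy.
    by rewrite !inE vy vY.
  have yB : y \in B.
    apply: contraLR leB => yB; rewrite -ltnNge; apply: hitY => //.
    apply/pred0P => v /=; apply/negbTE/negP => /andP[vB vY].
    by move: yB; rewrite -(BY v vB vY) vB.
  apply/eqP/setP => v; rewrite !inE; apply/andP/eqP => [[vB vY]|-> //].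
  exact: BY.
exists Y, (fun y => odflt set0 [pick B | good y B]); split; last split=> //.
  rewrite ltnNge; apply/negP => leY.
  have [|B [sB iB cB]] := rob (x |: Y).
    by rewrite cardsU1; case: (x \in Y) => /=; lia.
  have : #|B| < a.
    apply: hitY => //.
      by apply: subset_trans sB _; apply: setDS; rewrite sub1set !inE eqxx.
    apply/pred0P => v /=; apply/negbTE/negP => /andP[vB vY].
    by have := subsetP sB v vB; rewrite !inE vY orbT.
  by rewrite cB ltnn.
move=> y yY; case: pickP => [B /and4P[? ? /eqP ? /eqP ?] | none] //=.
by have [B gB] := exJ y yY; move: (none B); rewrite gB.
Qed.

(** Let P be the set of the y in Y with z in J y, and let A be J y1 :\ y1 for
    some y1 in P.  Expansion of A is not enough, since P has to be discounted:
    the point is that A has #|A| + K neighbours outside P.  Since N(A) outside P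
    is disjoint from both A and P, this bounds #|P|. *)
Lemma multiplicity (T : finType) (G : graph T) (X Y : {set T})
    (J : T -> {set T}) (K a : nat) x z :
  robust G X K.+1 a -> critical_star G X a x Y J ->
  #|[set y in Y | z \in J y]| <= #|X| + 2 - (2 * a + K).
Proof.
move=> rob [hitY Jspec]; have expan := robust_expansion rob.
have JX y : y \in Y -> J y \subset X.
  by case/Jspec => sJ _ _ _; apply: subset_trans sJ (subsetDl _ _).
have JY y v : y \in Y -> v \in J y -> v \in Y -> v = y.
  by case/Jspec => _ _ _ e vJ vY; apply/set1P; rewrite -e inE vJ.
have yJ y : y \in Y -> y \in J y.
  by case/Jspec => _ _ _ /setP/(_ y); rewrite !inE eqxx => /andP[].
set P := [set y in Y | z \in J y].
have [-> | /set0Pn[y1]] := eqVneq P set0; first by rewrite cards0.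
rewrite inE => /andP[y1Y zJ1].
have [sJ1 iJ1 cJ1 eJ1] := Jspec _ y1Y.
(* A vertex z of Y lies in J z only, so it remains to see that the right-hand
   side is positive, which is expansion of the a-set J y1. *)
have [zY | zY] := boolP (z \in Y).
  have : #|P| <= 1.
    rewrite -(cards1 z); apply/subset_leq_card/subsetP => y.
    by rewrite !inE => /andP[yY zJ]; rewrite eq_sym; apply/eqP; apply: JY zY.
  have /(expan _ (JX _ y1Y) iJ1) : J y1 != set0 by apply/set0Pn; exists z.
  have : #|nbhd G (J y1) :&: X| <= #|X :\: J y1|.
    apply/subset_leq_card/subsetP => v /setIP[vN vX]; rewrite inE vX andbT.
    by rewrite (disjointFl (independent_nbhd iJ1) vN).
  have := cardsID (J y1) X; rewrite (setIidPr (JX _ y1Y)) cJ1; card_lia.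
(* If A has a neighbour y in P, pass to A :&: J y.  It still contains z, and it
   has lost the neighbour y.  Exchanging in J y the neighbours of A for A
   removes y, hence yields a set missing Y, so of size less than a; therefore
   the number of neighbours outside P decreases at least as much as the size of
   A.  Once no neighbour in P is left, plain expansion applies: z keeps the set
   nonempty. *)
have key (A : {set T}) : A \subset X :\ x -> independent G A ->
    [disjoint A & Y] -> z \in A -> #|A| + K <= #|(nbhd G A :&: X) :\: P|.
  have [m] := ubnP #|nbhd G A :&: P|; elim: m A => // m IHm A ltm sAx iA dA zA.
  have sAX : A \subset X by apply: subset_trans sAx (subsetDl _ _).
  have [P0 | /set0Pn[y /setIP[yN]]] := eqVneq (nbhd G A :&: P) set0.
    rewrite (_ : _ :\: P = nbhd G A :&: X).
      by apply: expan => //; apply/set0Pn; exists z.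
    apply/setP => v; move/setP/(_ v): P0; rewrite !in_setD !in_setI in_set0.
    by case: (v \in nbhd G A) (v \in P) => [] [].
  rewrite inE => /andP[yY zJ]; have [sJ iJ cJ eJ] := Jspec _ yY.
  have [iE cE] := exchange iA iJ.
  have : #|A :|: (J y :\: nbhd G A)| < a.
    apply: hitY => //.
      by rewrite subUset sAx (subset_trans (subsetDl _ _)).
    apply/pred0P => v /=; apply/negbTE/negP => /andP[/setUP[vA | vJ] vY].
      by move: vY; rewrite (disjointFr dA vA).
    by case/setDP: vJ => vJ; rewrite (JY _ _ yY vJ vY) yN.
  set A' := A :&: J y; set D := (nbhd G A :&: X) :\: P.
  have sA'A : A' \subset A by apply: subsetIl.
  have ltA' : #|nbhd G A' :&: P| < m.
    rewrite -ltnS; apply: leq_trans ltm; rewrite ltnS.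
    apply: proper_card; apply/properP; split.
      by apply: setSI; apply: nbhdS.
    exists y; first by rewrite in_setI yN inE yY zJ.
    apply/negP => /setIP[/nbhdP[u /setIP[_ uJ] uy] _].
    by move/independentP: iJ => /(_ u y uJ (yJ _ yY)); rewrite uy.
  have := IHm A' ltA' (subset_trans sA'A sAx) (independent_sub sA'A iA)
    (disjointWl sA'A dA).
  rewrite inE zA zJ => /(_ isT).
  have : #|J y :&: nbhd G A| <= 1 + #|D :&: J y|.
    rewrite -(cards1 y); apply: leq_trans (leq_card_setU _ _).
    apply/subset_leq_card/subsetP => v /setIP[vJ vN].
    rewrite in_setU in_set1 in_setI in_setD in_setI vJ vN.
    rewrite (subsetP (JX _ yY) v vJ) andbT /=.
    rewrite andbT inE negb_and -implybE; case: eqP => //= vy.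
    by apply/implyP => vY; case: vy; apply: JY yY vJ vY.
  have : #|(nbhd G A' :&: X) :\: P| <= #|D :\: J y|.
    apply/subset_leq_card/subsetP => v; rewrite !in_setD !in_setI.
    move=> /and3P[-> vN ->]; rewrite (subsetP (nbhdS _ sA'A) v vN) !andbT.
    apply/negP => vJ; case/nbhdP: vN => u /setIP[_ uJ] uv.
    by move/independentP: iJ => /(_ u v uJ vJ); rewrite uv.
  have := cardsID (J y) D; have := cardsID (J y) A; rewrite -/A'.
  move: cE cJ; card_lia.
set A := J y1 :\ y1.
have cA : #|A| + 1 = a by rewrite -cJ1 [RHS](cardsD1 y1) yJ // addnC.
have sAJ : A \subset J y1 by apply: subD1set.
have := key A (subset_trans sAJ sJ1) (independent_sub sAJ iJ1).
have -> : [disjoint A & Y].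
  apply/pred0P => v /=; apply/negbTE/negP => /andP[/setD1P[vy vJ] vY].
  by case/eqP: vy; apply: JY y1Y vJ vY.
have -> : z \in A.
  by rewrite !inE zJ1 andbT; apply: contraNneq zY => ->.
move=> /(_ isT isT).
have : #|(nbhd G A :&: X) :\: P| + #|P| + #|A| <= #|X|.
  have <- := cardsID (A :|: P) X.
  have -> : X :&: (A :|: P) = A :|: P.
    apply/setIidPr; rewrite subUset (subset_trans sAJ (JX _ y1Y)) /=.
    apply/subsetP => y; rewrite inE => /andP[yY _].
    exact: subsetP (JX _ yY) y (yJ _ yY).
  rewrite cardsU (_ : A :&: P = set0) ?cards0; last first.
    apply/setP => v; rewrite !inE; apply/negbTE/negP => /and3P[/andP[vy vJ] vY _].
    by case/eqP: vy; apply: JY y1Y vJ vY.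
  have : #|(nbhd G A :&: X) :\: P| <= #|X :\: (A :|: P)|; last by card_lia.
  apply/subset_leq_card/subsetP => v; rewrite !in_setD in_setI in_setU.
  case/and3P => vP vN vX; rewrite negb_or vP vX !andbT.
  by rewrite (disjointFl (independent_nbhd (independent_sub sAJ iJ1)) vN).
move: cA; card_lia.
Qed.

(** Double counting of the pairs (y, v) with y in Y and v in J y, for a critical
    star at any vertex x. *)
Lemma robust_bound (T : finType) (G : graph T) (X : {set T}) (K a : nat) :
  robust G X K.+1 a ->
  K.+1 * a <= (#|X| + 2 - (2 * a + K)) * #|X|.
Proof.
move=> rob; case: (posnP a) => [-> | a0]; first by rewrite muln0.
have [x xX] : exists x, x \in X.
  case: (rob) => _ /(_ set0) []; rewrite ?cards0 // => J [sJ _ cJ].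
  have /card_gt0P[x xJ] : 0 < #|J| by rewrite cJ.
  by exists x; move/(subsetP sJ): xJ; rewrite !inE.
have [Y [J [ltY star]]] := critical_family rob xX.
have mult z := multiplicity z rob star; have [_ Jspec] := star.
apply: (@leq_trans (\sum_(y in Y) #|J y|)).
  rewrite (eq_bigr (fun=> a)) => [|y /Jspec[]//].
  by rewrite sum_nat_const leq_mul2r ltY orbT.
have -> : \sum_(y in Y) #|J y| = \sum_(z in X) #|[set y in Y | z \in J y]|.
  transitivity (\sum_(y in Y) \sum_(z in X | z \in J y) 1).
    apply: eq_bigr => y /Jspec[sJ _ _ _]; rewrite sum1dep_card.
    apply: eq_card => z; rewrite [RHS]inE andb_idl // => zJ.
    by have := subsetP sJ z zJ; rewrite inE => /andP[].
  rewrite (exchange_big_dep (mem X)) => [|y z _ /andP[] //] /=.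
  apply: eq_bigr => z zX; rewrite sum1dep_card; apply: eq_card => y.
  by rewrite !inE zX.
rewrite mulnC -sum_nat_const; apply: leq_sum => z _; exact: mult.
Qed.

(** * The independence number of tight (k,1)-stable graphs *)

Lemma leq_alpha (T : finType) (G : graph T) (J : {set T}) :
  independent G J -> #|J| <= alpha G.
Proof. by move=> iJ; apply: (bigmax_sup J). Qed.

Lemma alpha_attained (T : finType) (G : graph T) :
  exists2 J : {set T}, independent G J & #|J| = alpha G.
Proof.
have i0 : independent G set0 by apply/independentP => x y; rewrite inE.
have [|J iJ eJ] := @eq_bigmax_cond _ (independent G) (fun A : {set T} => #|A|).
  by apply/card_gt0P; exists set0.
by exists J.
Qed.

Lemma delete_attained (T : finType) (G : graph T) (S : {set T}) :
  exists J : {set T},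
    [/\ J \subset ~: S, independent G J & #|J| = alpha (delete G S)].
Proof.
have [J iJ cJ] := alpha_attained (delete G S); exists (val @: J); split.
- by apply/subsetP => _ /imsetP[x _ ->]; apply: (valP x).
- apply/independentP => _ _ /imsetP[x xJ ->] /imsetP[y yJ ->].
  by move/independentP: iJ => /(_ x y xJ yJ).
- by rewrite card_imset //; apply: val_inj.
Qed.

Lemma stable_avoid (T : finType) (G : graph T) (k l : nat) (S : {set T}) :
  stable k l G -> k <= #|T| -> #|S| <= k ->
  exists J : {set T},
    [/\ J \subset ~: S, independent G J & alpha G - l <= #|J|].
Proof.
move=> stG lekT leSk.
have [|S' sSS' cS'] := @exists_superset_card T S k; first by rewrite leSk.
have [J [sJ iJ cJ]] := delete_attained G S'; exists J; split=> //.
  by apply: subset_trans sJ _; rewrite setCS.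
by rewrite cJ; apply: stG.
Qed.

(** The third hypothesis is half of tightness.  If a set S of at most k - 12
    vertices lowers alpha, stability prevents any superset of S of size at most
    k from lowering it further, so G - S is robust for k - |S| >= 12 deletions,
    with independence number a = alpha G - 1 and |V - S| <= 2a + (k - |S|).  Each
    vertex is then in at most 3 sets of a critical star, and
    12 > 3 * 2 makes the count effective: a <= 6.  Otherwise G is robust for
    k - 12 deletions, the multiplicity is at most 13, and the count gives
    alpha G <= 14 once k is well above 12 + 13 * 2. *)
Lemma stable1_alpha_le (T : finType) (G : graph T) (k : nat) :
  stable k 1 G -> k <= #|T| -> #|T| + 2 <= k + 2 * alpha G -> 300 <= k ->
  alpha G <= 14.
Proof.
move=> stG lekT leT gek.
pose drops (S : {set T}) := (#|S| <= k - 12) && [forall J : {set T},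
  (J \subset ~: S) && independent G J ==> (#|J| < alpha G)].
have [/existsP[S /andP[leS /forallP dropS]] | none] := boolP [exists S, drops S].
  have rob : robust G (~: S) (k - #|S|).-1.+1 (alpha G).-1.
    split=> [J sJ iJ | R leR].
      by have := dropS J; rewrite sJ iJ /=; card_lia.
    have [|J [sJ iJ leJ]] := @stable_avoid _ _ _ _ (S :|: R) stG lekT.
      by have := leq_of_leqif (leq_card_setU S R); move: leR leS gek; card_lia.
    exists J; have sJS : J \subset ~: S.
      by apply: subset_trans sJ _; rewrite setCS subsetUl.
    split=> //; first by rewrite setDE -setCU.
    by have := dropS J; rewrite sJS iJ /=; move: leJ; card_lia.
  have := robust_bound rob; have := cardsC S; move: leT leS gek; clear.
  move: (#|S|) (#|~: S|) (#|T|) (alpha G) => s c n a; nia.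
have rob : robust G setT (k - 13).+1 (alpha G).
  split=> [J _ iJ | S leS]; first exact: leq_alpha.
  have : ~~ drops S by move/existsPn: none.
  rewrite /drops (_ : #|S| <= k - 12) /=; last by move: leS gek; card_lia.
  case/forallPn => J; rewrite negb_imply -leqNgt => /andP[/andP[sJ iJ] leJ].
  exists J; split=> //; first by rewrite setTD.
  by apply/eqP; rewrite eqn_leq leJ leq_alpha.
have := robust_bound rob; rewrite cardsT; move: leT lekT gek; clear.
move: (#|T|) (alpha G) => n a; nia.
Qed.

(** * From bounded independence number to at most k + 2 vertices *)

Lemma ramsey_propertyE (s t : nat) : ramsey_property s t (ramsey s t).
Proof. by rewrite /ramsey; case: ex_minnP => N /boolp.asboolP. Qed.

(** Witnessed by an edgeless graph; it is only meant to make k large. *)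
Lemma leq_ramsey (s t : nat) : 1 < t -> s <= ramsey s t.
Proof.
move=> t1; set N := ramsey s t.
have esym : symmetric (fun _ _ : 'I_N => false) by [].
have eirr : irreflexive (fun _ _ : 'I_N => false) by [].
have := @ramsey_propertyE s t _ (Graph esym eirr).
rewrite card_ord => /(_ (leqnn _)) [[A [_ <-]] | [A [cA tA]]].
  by rewrite -[X in _ <= X]card_ord max_card.
move: t1; rewrite -tA => /card_gt1P[x [y [xA yA xy]]].
by move/forall_inP/(_ x xA)/forall_inP/(_ y yA): cA; rewrite xy.
Qed.

Lemma alpha_gt0 (T : finType) (G : graph T) : 0 < #|T| -> 0 < alpha G.
Proof.
case/card_gt0P => x _; rewrite -(cards1 x); apply: leq_alpha.
by apply/independentP => u v /set1P-> /set1P->; rewrite adj_irr.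
Qed.

Lemma clique_independent_card (T : finType) (G : graph T) (Q J : {set T}) :
  clique G Q -> independent G J -> J \subset Q -> #|J| <= 1.
Proof.
move=> /forall_inP cQ /independentP iJ /subsetP sJ; rewrite leqNgt.
apply/negP => /card_gt1P[x [y [xJ yJ xy]]].
have /forall_inP/(_ y (sJ y yJ)) := cQ x (sJ x xJ).
by rewrite xy (negbTE (iJ x y xJ yJ)).
Qed.

(** Since alpha G <= 14, the Ramsey property yields a clique Q of size t, and
    t > 26 >= n - k.  Deleting k vertices so that only n - k vertices of Q
    remain leaves an independence number at most 1, which stability compares
    with alpha G - 1. *)
Lemma tight_card_le (T : finType) (G : graph T) (k s t : nat) :
  tight k 1 G -> ramsey s t <= k -> 300 <= k -> 14 < s -> 26 < t ->
  #|T| <= k + 2.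
Proof.
move=> [stG eqa] leRk gek ges get; rewrite leqNgt; apply/negP => ltT.
have lekT : k <= #|T| by lia.
have le14 : alpha G <= 14.
  apply: stable1_alpha_le stG lekT _ gek.
  by move: eqa ltT; clear; move: (#|T|) (alpha G) => n a; lia.
have [[A [iA cA]] | [Q [cQ tQ]]] := ramsey_propertyE G (leq_trans leRk lekT).
  by have := leq_alpha iA; rewrite cA leqNgt (leq_ltn_trans le14).
have [|W sWQ cW] := @exists_subset_card T Q (#|T| - k).
  move: eqa le14 get lekT; rewrite -tQ; clear.
  by move: (#|T|) (alpha G) (#|Q|) => n a q; lia.
have leS : #|~: W| <= k by have := cardsC W; move: cW lekT; card_lia.
have [J [sJ iJ leJ]] := stable_avoid stG lekT leS.
have := clique_independent_card cQ iJ; rewrite -(setCK W) in sWQ.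
move=> /(_ (subset_trans sJ sWQ)).
by move: leJ eqa ltT; clear; move: (#|J|) (#|T|) (alpha G) => j n a; lia.
Qed.

(** * Graphs on k, k + 1 or k + 2 vertices *)

Lemma embedding_alpha_le (T T' : finType) (G : graph T) (H : graph T')
    (f : T -> T') :
  injective f -> (forall x y, adj H (f x) (f y) = adj G x y) ->
  alpha G <= alpha H.
Proof.
move=> injf adjf; have [J iJ <-] := alpha_attained G.
rewrite -(card_imset _ injf); apply: leq_alpha; apply/independentP.
move=> _ _ /imsetP[x xJ ->] /imsetP[y yJ ->]; rewrite adjf.
by move/independentP: iJ; apply.
Qed.

Lemma isomorphic_alpha (T T' : finType) (G : graph T) (H : graph T') :
  isomorphic G H -> alpha G = alpha H.
Proof.
case=> f [[g fK gK] adjf]; apply/eqP; rewrite eqn_leq.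
rewrite (embedding_alpha_le (can_inj fK) adjf).
apply: (embedding_alpha_le (can_inj gK)) => x y.
by rewrite -adjf !gK.
Qed.

Lemma isomorphic_card (T T' : finType) (G : graph T) (H : graph T') :
  isomorphic G H -> #|T| = #|T'|.
Proof. by case=> f [bijf _]; apply: bij_eq_card bijf. Qed.

Lemma isomorphic_ord (T : finType) (G : graph T) (n : nat) :
  #|T| = n -> exists H : graph 'I_n, isomorphic G H.
Proof.
case: n /; pose r (i j : 'I_#|T|) := adj G (enum_val i) (enum_val j).
have sr : symmetric r by move=> i j; apply: adj_sym.
have ir : irreflexive r by move=> i; apply: adj_irr.
exists (Graph sr ir), enum_rank; split; first exact: enum_rank_bij.
by move=> x y /=; rewrite /r !enum_rankK.
Qed.

Lemma alpha1_adjE (T : finType) (G : graph T) x y :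
  alpha G <= 1 -> adj G x y = (x != y).
Proof.
move=> le1; have [-> | xy] := eqVneq x y; first exact: adj_irr.
apply: contraLR le1 => nxy; rewrite -ltnNge.
have -> : 2 = #|[set x; y]| by rewrite cards2 xy.
apply: leq_alpha; apply/independentP => u v.
by case/set2P=> -> /set2P[] ->; rewrite ?adj_irr // adj_sym.
Qed.

Lemma alpha_complete_le1 (n : nat) : alpha (complete n) <= 1.
Proof.
have [J iJ <-] := alpha_attained (complete n).
apply: (@clique_independent_card _ (complete n) setT) => //.
by apply/forall_inP => i _; apply/forall_inP => j _; apply/implyP.
Qed.

Lemma spanning_subgraph_complete (n : nat) (H : graph 'I_n) :
  spanning_subgraph H (complete n).
Proof. by move=> x y; apply: contraTneq => ->; rewrite adj_irr. Qed.

Lemma stable1_of_alpha_le2 (T : finType) (G : graph T) (k : nat) :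
  alpha G <= 2 -> k < #|T| -> stable k 1 G.
Proof.
move=> le2 ltkT S cS; rewrite leq_subLR (leq_trans le2) // ltnS.
apply: alpha_gt0; rewrite card_sig (_ : #|_| = #|~: S|); last exact: eq_card.
by have := cardsC S; move: cS ltkT; card_lia.
Qed.

Theorem theorem1p8 (k : nat) (hk : ramsey (2 ^ 74) (2 ^ 75 - 6) <= k) :
  (forall (T : finType) (G : graph T), k <= #|T| ->
     (tight k 1 G <->
      isomorphic G (complete k) \/
      (exists H : graph 'I_(k + 1),
         spanning_subgraph H (complete (k + 1)) /\ alpha H = 2 /\
         isomorphic G H) \/
      (exists H : graph 'I_(k + 2),
         spanning_subgraph H (complete (k + 2)) /\ alpha H = 2 /\
         isomorphic G H))) /\
  (forall (T : finType) (G : graph T), tight k 1 G -> #|T| <= k + 2).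
Proof.
have ges : 300 <= 2 ^ 74 by apply: (@leq_trans (2 ^ 9)); rewrite ?leq_exp2l.
have get : 26 < 2 ^ 75 - 6.
  have le6 : 2 ^ 6 <= 2 ^ 75 by rewrite leq_exp2l.
  exact: leq_trans (isT : 26 < 2 ^ 6 - 6) (leq_sub2r 6 le6).
(* Both numbers are too large for unary computation, so they are abstracted. *)
move: (2 ^ 74) (2 ^ 75 - 6) hk ges get => s t hk ges get.
have gek : 300 <= k.
  by apply: leq_trans ges (leq_trans (leq_ramsey s _) hk); apply: leq_trans get.
have bound (T : finType) (G : graph T) : tight k 1 G -> #|T| <= k + 2.
  by move=> tG; apply: tight_card_le tG hk gek _ get; apply: leq_trans ges.
split=> // T G lekT; split=> [tG | ].
  have leT := bound _ _ tG; case: tG => _ eqa.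
  have [eT | [eT | eT]] : #|T| = k \/ #|T| = k + 1 \/ #|T| = k + 2 by lia.
  - left; have [H isoGH] := isomorphic_ord G eT.
    have a1 : alpha H <= 1 by rewrite -(isomorphic_alpha isoGH); lia.
    case: isoGH => f [bijf adjf]; exists f; split=> // x y.
    by rewrite -adjf [RHS](alpha1_adjE _ _ a1).
  - right; left; have [H isoGH] := isomorphic_ord G eT; exists H.
    split; first exact: spanning_subgraph_complete.
    by split=> //; rewrite -(isomorphic_alpha isoGH); lia.
  - right; right; have [H isoGH] := isomorphic_ord G eT; exists H.
    split; first exact: spanning_subgraph_complete.
    by split=> //; rewrite -(isomorphic_alpha isoGH); lia.
case=> [isoG | [[H [_ [aH isoG]]] | [H [_ [aH isoG]]]]].
- have eT : #|T| = k by rewrite (isomorphic_card isoG) card_ord.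
  have a1 : alpha G = 1.
    apply/eqP; rewrite eqn_leq (isomorphic_alpha isoG) alpha_complete_le1.
    by apply: alpha_gt0; rewrite card_ord; lia.
  split; first by move=> S _; rewrite a1.
  by rewrite a1 eT; lia.
- have eT : #|T| = k + 1 by rewrite (isomorphic_card isoG) card_ord.
  have a2 : alpha G = 2 by rewrite (isomorphic_alpha isoG).
  split; first by apply: stable1_of_alpha_le2; rewrite ?a2 // eT addn1.
  by rewrite a2 eT; lia.
- have eT : #|T| = k + 2 by rewrite (isomorphic_card isoG) card_ord.
  have a2 : alpha G = 2 by rewrite (isomorphic_alpha isoG).
  split; first by apply: stable1_of_alpha_le2; rewrite ?a2 // eT addn2.
  by rewrite a2 eT; lia.
Qed.
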